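(* Let $f_1,\ldots,f_r$ be the basic relative invariants of a prehomogeneous vector space $(G,\rho,V)$, with corresponding characters $\chi_1,\ldots,\chi_r$. For each $i$ let $v_i\in V(f_i)$, with $v_i\notin V(f_j)$ for all $j\neq i$. (1) If $i\neq j$, then $G_{v_i}\subseteq\ker(\chi_j)$. (2) Suppose $h$ is a nonzero additive relative invariant with corresponding additive function $\Phi$, written as $h=\frac{h_1}{g_1}$, where $h_1$ and $g_1$ are homogeneous polynomials of equal degree without common factors and $g_1$ is a relative invariant, and let $g_1=f_1^{k_1}\cdots f_r^{k_r}$ be the factorization of $g_1$. Then: (a) If $k_i>0$ and $h_1(v_i)\neq 0$, then $G^0_{v_i}\subseteq\ker(\chi_i)$. (b) If $k_i=0$, then $G_{v_i}\subseteq\ker(\Phi)$.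
   Context: A prehomogeneous vector space $(G,\rho,V)$ is a rational representation $\rho:G\to\mathrm{GL}(V)$ of a connected complex linear algebraic group $G$ on a finite-dimensional complex vector space $V$ having a (unique) Zariski open orbit $\Omega\subseteq V$. $G_v$ is the isotropy subgroup of $G$ at $v$ and $G^0_v$ its identity component; $V(f)$ is the zero set of $f$. A relative invariant is a rational function $f$ on $V$, not identically $0$, for which there is a rational character $\chi:G\to\mathbb{G}_m=\mathrm{GL}_1(\mathbb{C})$ (the corresponding character) with $f(\rho(g)(v))=\chi(g)f(v)$ for all $v\in\Omega$, $g\in G$. The basic relative invariants are the irreducible polynomials defining the distinct irreducible hypersurface components of $V\setminus\Omega$ (they are relative invariants). An additive relative invariant is a rational function $h$ on $V$ for which there is a homomorphism of algebraic groups $\Phi:G\to\mathbb{G}_a=(\mathbb{C},+)$ (the corresponding additive function) with $h(\rho(g)(v))-h(v)=\Phi(g)$ for all $v\in\Omega$, $g\in G$. Every nonzero additive relative invariant can be written in the form $h_1/g_1$ described in (2). *)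

(* Defs.v *)
From HB Require Import structures.
From mathcomp Require Import all_boot all_order all_algebra.
From mathcomp Require Import fraction complex mpoly.
From mathcomp Require Import boolp classical_sets reals.
From mathcomp Require Import topology_structure connected.

Set Implicit Arguments.
Unset Strict Implicit.
Unset Printing Implicit Defensive.

Import GRing.Theory.
Local Open Scope classical_set_scope.
Local Open Scope ring_scope.
Local Open Scope complex_scope.

(* Polynomial functions on a finite-dimensional complex vector space V are
   polynomials in the linear coordinates given by a fixed basis of V. *)
Notation polyOn V := {mpoly _[\dim {:V}]}.

Definition peval (R : realType) (V : vectType R[i]) (p : polyOn V) (v : V) :
  R[i] := p.@[fun j => coord (vbasis {:V}) j v].

Definition zero_locus (R : realType) (V : vectType R[i]) (p : polyOn V) :
  set V := [set v | peval p v = 0].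

(* V equipped with its Zariski topology. *)
Definition zariski (R : realType) (V : vectType R[i]) : Type := V.

HB.instance Definition _ (R : realType) (V : vectType R[i]) :=
  Choice.on (zariski V).

Definition zariski_open (R : realType) (V : vectType R[i]) :
    set_system (zariski V) :=
  [set U | exists S : set (polyOn V), U = ~` \bigcap_(p in S) zero_locus p].

Lemma zariski_openT (R : realType) (V : vectType R[i]) :
  @zariski_open R V setT.
Proof.
exists [set 1]; rewrite bigcap_set1; apply/seteqP; split => // v _.
by rewrite /zero_locus /= /peval rmorph1; apply/eqP/oner_neq0.
Qed.

Lemma zariski_openI (R : realType) (V : vectType R[i]) :
  setI_closed (@zariski_open R V).
Proof.
move=> _ _ [S ->] [T ->].
exists [set r | exists2 p, S p & exists2 q, T q & r = p * q].
rewrite -setCU; congr (~` _); apply/seteqP; split => v /=.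
  move=> Hv r [p Sp [q Tq ->]]; rewrite /zero_locus /= /peval rmorphM.
  by case: Hv => [/(_ p Sp)|/(_ q Tq)]; rewrite /zero_locus /= /peval => ->;
    rewrite ?mul0r ?mulr0.
move=> Hv; apply: contrapT => /not_orP[nS nT]; apply: nS => p Sp.
apply: contrapT => np; apply: nT => q Tq.
have /eqP := Hv (p * q) (ex_intro2 _ _ p Sp (ex_intro2 _ _ q Tq erefl)).
by rewrite /peval rmorphM mulf_eq0 => /orP[] /eqP.
Qed.

Lemma zariski_open_bigU (R : realType) (V : vectType R[i]) (J : Type)
    (U : J -> set (zariski V)) :
  (forall j, zariski_open (U j)) -> zariski_open (\bigcup_j U j).
Proof.
move=> /choice[S US]; exists (\bigcup_j S j).
rewrite (eq_bigcupr (fun j _ => US j)) -setC_bigcap; congr (~` _).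
apply/seteqP; split => v /=; first by move=> Hv p [j _ Sp]; exact: (Hv j I p Sp).
by move=> Hv j _ p Sp; apply: Hv; exists j.
Qed.

HB.instance Definition _ (R : realType) (V : vectType R[i]) :=
  isOpenTopological.Build (zariski V)
    (@zariski_openT R V) (@zariski_openI R V) (@zariski_open_bigU R V).

Definition irreducible_set (T : topologicalType) (A : set T) : Prop :=
  A !=set0 /\
  forall F1 F2 : set T, closed F1 -> closed F2 ->
    A `<=` F1 `|` F2 -> A `<=` F1 \/ A `<=` F2.

Definition irreducible_component (T : topologicalType) (X Z : set T) : Prop :=
  [/\ Z `<=` X, irreducible_set Z &
      forall Y : set T, Y `<=` X -> irreducible_set Y -> Z `<=` Y -> Y = Z].

Definition hypersurface (R : realType) (V : vectType R[i]) (Z : set V) : Prop :=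
  exists2 p : polyOn V, ~ (exists c, p = c%:MP) & Z = zero_locus p.

Definition irreducible_elt (A : idomainType) (p : A) : Prop :=
  [/\ p != 0, p \isn't a GRing.unit &
      forall a b : A, p = a * b -> a \is a GRing.unit \/ b \is a GRing.unit].

Definition no_common_factor (A : idomainType) (p q : A) : Prop :=
  forall s a b : A, p = s * a -> q = s * b -> s \is a GRing.unit.

(* Linear algebraic groups are taken as Zariski closed subgroups of GL_m. *)
Record linear_algebraic_group (R : realType) (m : nat) (G : set 'M[R[i]]_m) :
    Prop := LinearAlgebraicGroup {
  lag_unit : forall g, G g -> g \in unitmx;
  lag_one : G 1%:M;
  lag_mul : forall g h, G g -> G h -> G (g *m h);
  lag_inv : forall g, G g -> G (invmx g);
  lag_closed : exists2 Z : set (zariski 'M[R[i]]_m),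
    closed Z & G = Z `&` [set g | g \in unitmx]
}.

(* The regular functions on a closed subset of GL_m are the restrictions of
   the elements of C[x_11, ..., x_mm, 1/det]. *)
Definition regular_on (R : realType) (m : nat) (G : set 'M[R[i]]_m)
    (phi : 'M[R[i]]_m -> R[i]) : Prop :=
  exists (p : polyOn 'M[R[i]]_m) (k : nat),
    forall g, G g -> phi g = peval p g / (\det g) ^+ k.

(* rho takes values in GL(V) on G, because rho 1 = 1 and rho is
   multiplicative. *)
Record rational_representation (R : realType) (m : nat) (G : set 'M[R[i]]_m)
    (V : vectType R[i]) (rho : 'M[R[i]]_m -> 'End(V)) : Prop :=
    RationalRepresentation {
  rep_one : rho 1%:M = \1%VF;
  rep_mul : forall g h, G g -> G h -> rho (g *m h) = (rho g \o rho h)%VF;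
  rep_regular : forall (v : V) (j : 'I_(\dim {:V})),
    regular_on G (fun g => coord (vbasis {:V}) j (rho g v))
}.

Definition rational_character (R : realType) (m : nat) (G : set 'M[R[i]]_m)
    (chi : 'M[R[i]]_m -> R[i]) : Prop :=
  [/\ regular_on G chi,
      forall g, G g -> chi g != 0 &
      forall g h, G g -> G h -> chi (g *m h) = chi g * chi h].

Definition rational_additive_function (R : realType) (m : nat)
    (G : set 'M[R[i]]_m) (Phi : 'M[R[i]]_m -> R[i]) : Prop :=
  regular_on G Phi /\
  forall g h, G g -> G h -> Phi (g *m h) = Phi g + Phi h.

Definition character_kernel (R : realType) (m : nat) (G : set 'M[R[i]]_m)
    (chi : 'M[R[i]]_m -> R[i]) : set 'M[R[i]]_m :=
  [set g | G g /\ chi g = 1].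

Definition additive_kernel (R : realType) (m : nat) (G : set 'M[R[i]]_m)
    (Phi : 'M[R[i]]_m -> R[i]) : set 'M[R[i]]_m :=
  [set g | G g /\ Phi g = 0].

Definition orbit_of (R : realType) (m : nat) (G : set 'M[R[i]]_m)
    (V : vectType R[i]) (rho : 'M[R[i]]_m -> 'End(V)) (v : V) : set V :=
  [set rho g v | g in G].

Definition isotropy (R : realType) (m : nat) (G : set 'M[R[i]]_m)
    (V : vectType R[i]) (rho : 'M[R[i]]_m -> 'End(V)) (v : V) :
    set 'M[R[i]]_m :=
  [set g | G g /\ rho g v = v].

Definition identity_component (R : realType) (m : nat) (H : set 'M[R[i]]_m) :
    set 'M[R[i]]_m :=
  connected_component (H : set (zariski 'M[R[i]]_m)) 1%:M.

Record prehomogeneous_space (R : realType) (m : nat) (G : set 'M[R[i]]_m)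
    (V : vectType R[i]) (rho : 'M[R[i]]_m -> 'End(V)) (Omega : set V) : Prop :=
    PrehomogeneousSpace {
  pv_group : linear_algebraic_group G;
  pv_connected : connected (G : set (zariski 'M[R[i]]_m));
  pv_rep : rational_representation G rho;
  pv_orbit : exists v, Omega = orbit_of G rho v;
  pv_open : open (Omega : set (zariski V))
}.

(* A rational function f on V is regular at v with value c. *)
Definition ratfun_value (R : realType) (V : vectType R[i])
    (f : {fraction (polyOn V)}) (v : V) (c : R[i]) : Prop :=
  exists p q : polyOn V,
    [/\ peval q v != 0, f = tofrac p / tofrac q & c = peval p v / peval q v].

(* The functional equations below are required to hold on all of Omega, so
   that in particular f and h are regular there. *)
Record relative_invariant (R : realType) (m : nat) (G : set 'M[R[i]]_m)
    (V : vectType R[i]) (rho : 'M[R[i]]_m -> 'End(V)) (Omega : set V)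
    (f : {fraction (polyOn V)}) (chi : 'M[R[i]]_m -> R[i]) : Prop :=
    RelativeInvariant {
  ri_neq0 : f != 0;
  ri_character : rational_character G chi;
  ri_eq : forall v g, Omega v -> G g -> exists a b : R[i],
    [/\ ratfun_value f v a, ratfun_value f (rho g v) b & b = chi g * a]
}.

Record additive_relative_invariant (R : realType) (m : nat)
    (G : set 'M[R[i]]_m) (V : vectType R[i]) (rho : 'M[R[i]]_m -> 'End(V))
    (Omega : set V) (h : {fraction (polyOn V)}) (Phi : 'M[R[i]]_m -> R[i]) :
    Prop := AdditiveRelativeInvariant {
  ari_function : rational_additive_function G Phi;
  ari_eq : forall v g, Omega v -> G g -> exists a b : R[i],
    [/\ ratfun_value h v a, ratfun_value h (rho g v) b & b - a = Phi g]
}.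

Record basic_relative_invariants (R : realType) (V : vectType R[i])
    (Omega : set V) (r : nat) (f : 'I_r -> polyOn V) : Prop :=
    BasicRelativeInvariants {
  bri_irreducible : forall i, irreducible_elt (f i);
  bri_distinct : injective (fun i => zero_locus (f i));
  bri_components : forall Z : set (zariski V),
    (exists i, Z = zero_locus (f i)) <->
    (irreducible_component (~` (Omega : set (zariski V))) Z /\ hypersurface Z)
}.

(* Main.v *)
Require Import Defs.
From HB Require Import structures.
From mathcomp Require Import all_boot all_order all_algebra.
From mathcomp Require Import perm fraction complex mpoly.
From mathcomp Require Import boolp classical_sets reals.
From mathcomp Require Import topology_structure connected.

Set Implicit Arguments.
Unset Strict Implicit.
Unset Printing Implicit Defensive.

Import GRing.Theory.
Local Open Scope classical_set_scope.
Local Open Scope ring_scope.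
Local Open Scope complex_scope.

(* Equivariance identities between polynomials hold on the dense open orbit,
   hence at v_i.  Evaluating f_j(gv) = chi_j(g) f_j(v) at v = v_i for g fixing
   v_i gives (1), and (b) follows in the same way after clearing denominators in
   h(gv) - h(v) = Phi(g).  For (a), let psi be the product of the chi_j^{k_j};
   dividing the cleared identity by g_1(v), which does not vanish on the orbit,
   leaves
     h_1(gv) - psi(g) h_1(v) = Phi(g) psi(g) g_1(v),
   whose value at v_i forces psi(g) = chi_i(g)^{k_i} = 1.  So chi_i takes finitely
   many values on the isotropy group, and it is 1 on the identity component. *)

(** * Polynomial functions on a vector space *)

(** Keeping only the existence of a polynomial allows linear substitutions and determinants to be
    handled by closure properties, without writing their coordinate expansions. *)
Definition polynomial_function (R : realType) (V : vectType R[i])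
    (F : V -> R[i]) : Prop :=
  exists p : polyOn V, forall v, F v = peval p v.

Lemma polynomial_function_peval (R : realType) (V : vectType R[i])
    (p : polyOn V) : polynomial_function (peval p).
Proof. by exists p. Qed.

Lemma polynomial_functionC (R : realType) (V : vectType R[i]) (c : R[i]) :
  @polynomial_function R V (fun=> c).
Proof. by exists c%:MP => v; rewrite /peval mevalC. Qed.

Lemma polynomial_functionD (R : realType) (V : vectType R[i])
    (F1 F2 : V -> R[i]) :
  polynomial_function F1 -> polynomial_function F2 ->
  polynomial_function (fun v => F1 v + F2 v).
Proof.
move=> [p pE] [q qE]; exists (p + q) => v.
by rewrite pE qE /peval mevalD.
Qed.

Lemma polynomial_functionM (R : realType) (V : vectType R[i])
    (F1 F2 : V -> R[i]) :
  polynomial_function F1 -> polynomial_function F2 ->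
  polynomial_function (fun v => F1 v * F2 v).
Proof.
move=> [p pE] [q qE]; exists (p * q) => v.
by rewrite pE qE /peval mevalM.
Qed.

Lemma polynomial_functionB (R : realType) (V : vectType R[i])
    (F1 F2 : V -> R[i]) :
  polynomial_function F1 -> polynomial_function F2 ->
  polynomial_function (fun v => F1 v - F2 v).
Proof.
move=> [p pE] [q qE]; exists (p - q) => v.
by rewrite pE qE /peval mevalB.
Qed.

Lemma polynomial_functionX (R : realType) (V : vectType R[i])
    (F : V -> R[i]) (n : nat) :
  polynomial_function F -> polynomial_function (fun v => F v ^+ n).
Proof.
by move=> [p pE]; exists (p ^+ n) => v; rewrite pE /peval rmorphXn.
Qed.

Lemma polynomial_function_sum (R : realType) (V : vectType R[i]) (I : Type)
    (s : seq I) (F : I -> V -> R[i]) :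
  (forall i, polynomial_function (F i)) ->
  polynomial_function (fun v => \sum_(i <- s) F i v).
Proof.
move=> /choice[p pE]; exists (\sum_(i <- s) p i) => v.
by rewrite /peval raddf_sum; apply: eq_bigr => i _; rewrite pE.
Qed.

Lemma polynomial_function_prod (R : realType) (V : vectType R[i]) (I : Type)
    (s : seq I) (F : I -> V -> R[i]) :
  (forall i, polynomial_function (F i)) ->
  polynomial_function (fun v => \prod_(i <- s) F i v).
Proof.
move=> /choice[p pE]; exists (\prod_(i <- s) p i) => v.
by rewrite /peval rmorph_prod; apply: eq_bigr => i _; rewrite pE.
Qed.

Lemma polynomial_function_linear (R : realType) (V : vectType R[i])
    (l : {scalar V}) : polynomial_function l.
Proof.
exists (\sum_(j < \dim {:V}) l (vbasis {:V})`_j *: 'X_j) => v.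
rewrite {1}(coord_vbasis (memvf v)) linear_sum /peval raddf_sum /=.
by apply: eq_bigr => j _; rewrite linearZ mevalZ mevalXU mulrC.
Qed.

Lemma polynomial_function_comp (R : realType) (V : vectType R[i])
    (L : 'End(V)) (p : polyOn V) : polynomial_function (fun v => peval p (L v)).
Proof.
rewrite /peval; under eq_fun do rewrite mevalE.
apply: polynomial_function_sum => m.
apply: polynomial_functionM; first exact: polynomial_functionC.
apply: polynomial_function_prod => j; apply: polynomial_functionX.
exact: (polynomial_function_linear (coord (vbasis {:V}) j \o L)).
Qed.

(** Coordinates are taken in [vbasis], not in the matrix entries, so each entry enters the Leibniz
    formula as a linear form. *)
Lemma polynomial_function_det (R : realType) (m : nat) :
  polynomial_function (fun g : 'M[R[i]]_m => \det g).
Proof.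
rewrite /determinant; apply: polynomial_function_sum => s.
apply: polynomial_functionM; first exact: polynomial_functionC.
apply: polynomial_function_prod => j.
have lin : linear_for *%R (fun g : 'M[R[i]]_m => g j (s j)).
  by move=> a g h; rewrite !mxE.
pose l : {scalar 'M[R[i]]_m} :=
  HB.pack (fun g : 'M[R[i]]_m => g j (s j)) (GRing.isLinear.Build _ _ _ _ _ lin).
exact: (polynomial_function_linear l).
Qed.

(** * Density of nonempty Zariski open sets *)

Lemma peval_line (R : realType) (V : vectType R[i]) (p : polyOn V) (a b : V) :
  exists P : {poly R[i]}, forall t, peval p (a + t *: b) = P.[t].
Proof.
exists (\sum_(m <- msupp p) p@_m *: \prod_j
  ((coord (vbasis {:V}) j a)%:P + coord (vbasis {:V}) j b *: 'X) ^+ m j) => t.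
rewrite /peval mevalE horner_sum; apply: eq_bigr => m _.
rewrite hornerZ horner_prod; congr (_ * _); apply: eq_bigr => j _.
by rewrite horner_exp hornerD hornerC hornerZ hornerX linearD linearZ mulrC.
Qed.

Lemma poly_eq0_horner (F : numDomainType) (P : {poly F}) :
  (forall t, P.[t] = 0) -> P = 0.
Proof.
move=> P0; apply/eqP/negPn/negP => Pn0.
(* These are [size P] distinct roots, one more than the degree allows. *)
pose s := [seq i%:R : F | i <- iota 0 (size P)].
have := @max_poly_roots _ P s Pn0.
rewrite size_map size_iota ltnn => H; suff: false by []; apply: H.
  by apply/allP => t _; rewrite /root P0.
rewrite map_inj_in_uniq ?iota_uniq //.
move=> a b _ _ /eqP.
by rewrite Num.Theory.eqr_nat => /eqP.
Qed.

(** Restriction to the line from a point [w] of [U] to [u] reduces the claim to the absence of zero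
    divisors among polynomials in one variable. *)
Lemma zariski_open_dense (R : realType) (V : vectType R[i])
    (U : set (zariski V)) (F : V -> R[i]) :
  open U -> U !=set0 -> polynomial_function F ->
  (forall u : V, U u -> F u = 0) -> forall u, F u = 0.
Proof.
move=> [S ->] [w]; rewrite /setC /= => wS [q qE] F0 u.
have [p Sp pw] : exists2 p, S p & peval p w != 0.
  apply: contrapT => np; apply: wS => p Sp; apply: contrapT => pw.
  by apply: np; exists p => //; apply/eqP.
have [P PE] := peval_line p w (u - w).
have [Q QE] := peval_line q w (u - w).
have : P * Q = 0.
  apply: poly_eq0_horner => t.
  rewrite hornerM -PE -QE -qE.
  (* A point where [p] does not vanish lies in [U], where [F] is zero. *)
  have [-> | pt] := eqVneq (peval p (w + t *: (u - w))) 0; first by rewrite mul0r.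
  by rewrite F0 ?mulr0 // => /(_ p Sp) /eqP; rewrite (negPf pt).
move=> /eqP; rewrite mulf_eq0 => /orP[] /eqP E0.
  (* The line is at [w] for [t = 0], which excludes [P = 0], and at [u] for [t = 1]. *)
  by have := PE 0; rewrite scale0r addr0 E0 horner0 => /eqP; rewrite (negPf pw).
by have := QE 1; rewrite scale1r subrKC E0 horner0 -qE.
Qed.

Lemma closed_zeros (R : realType) (V : vectType R[i]) (F : V -> R[i]) :
  polynomial_function F -> closed ([set v | F v = 0] : set (zariski V)).
Proof.
move=> [p pE]; rewrite -openC; exists [set p].
by rewrite bigcap_set1; congr (~` _); apply/seteqP; split=> v /=;
  rewrite /zero_locus /= pE.
Qed.

(** * From rational functions to polynomial identities on all of [V] *)

(** The value [a] may come from another fraction [p / q]; cross-multiplying divides only by [q] at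
    [v], so [g] may vanish there. *)
Lemma ratfun_value_frac (R : realType) (V : vectType R[i]) (h g : polyOn V)
    (v : V) (a : R[i]) :
  g != 0 -> ratfun_value (tofrac h / tofrac g) v a ->
  peval h v = a * peval g v.
Proof.
move=> g0 [p [q [qv hq ->]]].
have q0 : q != 0 by apply: contra_neq qv => ->; rewrite /peval meval0.
move/eqP: hq; rewrite eqr_div ?tofrac_eq0 // -!tofracM tofrac_eq => /eqP hq.
have {hq} : peval h v * peval q v = peval p v * peval g v.
  by rewrite /peval -!mevalM hq.
by move=> E; rewrite mulrAC -E mulfK.
Qed.

Lemma ratfun_value_poly (R : realType) (V : vectType R[i]) (h : polyOn V)
    (v : V) (a : R[i]) : ratfun_value (tofrac h) v a -> peval h v = a.
Proof.
rewrite -[X in ratfun_value X]divr1 -tofrac1 => /ratfun_value_frac.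
by rewrite oner_eq0 /peval meval1 mulr1 => ->.
Qed.

Lemma orbit_nonempty (R : realType) (m : nat) (G : set 'M[R[i]]_m)
    (V : vectType R[i]) (rho : 'M[R[i]]_m -> 'End(V)) (Omega : set V) :
  prehomogeneous_space G rho Omega -> Omega !=set0.
Proof.
move=> [Ggrp _ _ [w ->] _]; exists (rho 1%:M w); exists 1%:M => //.
exact: (lag_one Ggrp).
Qed.

Lemma orbit_dense (R : realType) (m : nat) (G : set 'M[R[i]]_m)
    (V : vectType R[i]) (rho : 'M[R[i]]_m -> 'End(V)) (Omega : set V)
    (F : V -> R[i]) :
  prehomogeneous_space G rho Omega -> polynomial_function F ->
  (forall u, Omega u -> F u = 0) -> forall u, F u = 0.
Proof.
move=> hV; apply: (zariski_open_dense (pv_open hV)).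
exact: (orbit_nonempty hV).
Qed.

Lemma relative_invariant_eq (R : realType) (m : nat) (G : set 'M[R[i]]_m)
    (V : vectType R[i]) (rho : 'M[R[i]]_m -> 'End(V)) (Omega : set V)
    (p : polyOn V) (chi : 'M[R[i]]_m -> R[i]) :
  prehomogeneous_space G rho Omega ->
  relative_invariant G rho Omega (tofrac p) chi ->
  forall g u, G g -> peval p (rho g u) = chi g * peval p u.
Proof.
move=> hV [_ _ inv] g u Gg; apply/eqP; rewrite -subr_eq0; apply/eqP.
apply: (orbit_dense (F := fun u => peval p (rho g u) - chi g * peval p u) hV).
  apply: polynomial_functionB; first exact: polynomial_function_comp.
  apply: polynomial_functionM; first exact: polynomial_functionC.
  exact: polynomial_function_peval.
move=> {}u Ou; have [a [b [ua ub bE]]] := inv u g Ou Gg.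
by rewrite (ratfun_value_poly ua) (ratfun_value_poly ub) bE subrr.
Qed.

Lemma isotropy_character (R : realType) (m : nat) (G : set 'M[R[i]]_m)
    (V : vectType R[i]) (rho : 'M[R[i]]_m -> 'End(V)) (Omega : set V)
    (p : polyOn V) (chi : 'M[R[i]]_m -> R[i]) (u : V) :
  prehomogeneous_space G rho Omega ->
  relative_invariant G rho Omega (tofrac p) chi -> peval p u != 0 ->
  isotropy G rho u `<=` character_kernel G chi.
Proof.
move=> hV inv pu g [Gg gu]; split=> //; apply: (mulIf pu).
by rewrite mul1r -(relative_invariant_eq hV inv u Gg) gu.
Qed.

Lemma basic_relative_invariant_neq0 (R : realType) (V : vectType R[i])
    (Omega : set V) (r : nat) (f : 'I_r -> polyOn V) (i : 'I_r) (u : V) :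
  basic_relative_invariants Omega f -> Omega u -> peval (f i) u != 0.
Proof.
move=> [_ _ comp] Ou; apply/eqP => fu.
have [|[sub _ _] _] := (comp (zero_locus (f i))).1; first by exists i.
exact: (sub u fu).
Qed.

Lemma additive_invariant_eq (R : realType) (m : nat) (G : set 'M[R[i]]_m)
    (V : vectType R[i]) (rho : 'M[R[i]]_m -> 'End(V)) (Omega : set V)
    (h1 g1 : polyOn V) (Phi : 'M[R[i]]_m -> R[i]) :
  prehomogeneous_space G rho Omega -> g1 != 0 ->
  additive_relative_invariant G rho Omega (tofrac h1 / tofrac g1) Phi ->
  forall g u, G g -> peval h1 (rho g u) * peval g1 u =
    (peval h1 u + Phi g * peval g1 u) * peval g1 (rho g u).
Proof.
move=> hV g10 [_ inv] g u Gg; apply/eqP; rewrite -subr_eq0; apply/eqP.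
pose F u := peval h1 (rho g u) * peval g1 u -
  (peval h1 u + Phi g * peval g1 u) * peval g1 (rho g u).
apply: (orbit_dense (F := F) hV).
  apply: polynomial_functionB; apply: polynomial_functionM.
  - exact: polynomial_function_comp.
  - exact: polynomial_function_peval.
  - apply: polynomial_functionD; first exact: polynomial_function_peval.
    apply: polynomial_functionM; first exact: polynomial_functionC.
    exact: polynomial_function_peval.
  - exact: polynomial_function_comp.
move=> {}u Ou; have [a [b [ua ub PhiE]]] := inv u g Ou Gg.
rewrite /F -PhiE (ratfun_value_frac g10 ua) (ratfun_value_frac g10 ub).
by rewrite -mulrDl [a + _]addrC subrK mulrAC subrr.
Qed.

(** At a zero of [g1] the identity of [additive_invariant_eq] degenerates to [0 = 0]. Cancelling
    [g1] on the orbit first, and extending by density afterwards, keeps the information at such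
    points. *)
Lemma additive_relative_invariant_eq (R : realType) (m : nat)
    (G : set 'M[R[i]]_m) (V : vectType R[i]) (rho : 'M[R[i]]_m -> 'End(V))
    (Omega : set V) (h1 g1 : polyOn V) (Phi psi : 'M[R[i]]_m -> R[i]) :
  prehomogeneous_space G rho Omega ->
  additive_relative_invariant G rho Omega (tofrac h1 / tofrac g1) Phi ->
  (forall g u, G g -> peval g1 (rho g u) = psi g * peval g1 u) ->
  (forall u, Omega u -> peval g1 u != 0) ->
  forall g u, G g -> peval h1 (rho g u) =
    psi g * (peval h1 u + Phi g * peval g1 u).
Proof.
move=> hV ari g1E g1n0 g u Gg.
have g10 : g1 != 0.
  have [w /g1n0] := orbit_nonempty hV.
  by apply: contra_neq => ->; rewrite /peval meval0.
apply/eqP; rewrite -subr_eq0; apply/eqP.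
pose F u := peval h1 (rho g u) - psi g * (peval h1 u + Phi g * peval g1 u).
apply: (orbit_dense (F := F) hV).
  apply: polynomial_functionB; first exact: polynomial_function_comp.
  apply: polynomial_functionM; first exact: polynomial_functionC.
  apply: polynomial_functionD; first exact: polynomial_function_peval.
  apply: polynomial_functionM; first exact: polynomial_functionC.
  exact: polynomial_function_peval.
move=> {}u Ou; apply/eqP; rewrite subr_eq0; apply/eqP; apply: (mulIf (g1n0 u Ou)).
by rewrite (additive_invariant_eq hV g10 ari u Gg) g1E // mulrCA mulrA.
Qed.

(** * Connected sets and characters of finite order *)

(** Inside [C] the set [A] agrees with the complement of [B], so its trace on [C] is both relatively
    closed and relatively open. *)
Lemma connected_clopen_cover (T : topologicalType) (C A B : set T) :
  connected C -> closed A -> closed B -> C `<=` A `|` B ->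
  A `&` B `&` C = set0 -> C `&` A !=set0 -> C `<=` A.
Proof.
move=> Cc Acl Bcl CAB AB0 CA0.
suff <- : C `&` A = C by move=> x [].
apply: Cc => //; last by exists A.
exists (~` B); first by rewrite openC.
apply/seteqP; split=> x [Cx].
  by move=> Ax; split=> // Bx; have : set0 x by rewrite -AB0.
by move=> nBx; split=> //; case: (CAB x Cx).
Qed.

(** Among the [k]-th roots of unity, 1 is separated from the others by closed conditions: the two
    factors of [x ^+ k - 1] split [C] into disjoint closed pieces. *)
Lemma connected_torsion_character (R : realType) (m : nat)
    (G C : set 'M[R[i]]_m) (chi : 'M[R[i]]_m -> R[i]) (k : nat) :
  (0 < k)%N -> (forall g, G g -> g \in unitmx) -> regular_on G chi ->
  connected (C : set (zariski 'M[R[i]]_m)) -> C `<=` G ->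
  (exists2 g, C g & chi g = 1) -> (forall g, C g -> chi g ^+ k = 1) ->
  forall g, C g -> chi g = 1.
Proof.
move=> k0 Gu [p [n chiE]] Cc CG [g0 Cg0 chi1] chik.
(* The factor [\sum_(l < k) x ^+ l] of [x ^+ k - 1], homogenised by [\det ^+ n]
   to clear the denominator of [chi], does not vanish at [x = 1] because the
   characteristic is 0. *)
pose N (g : 'M[R[i]]_m) := peval p g - \det g ^+ n.
pose S (g : 'M[R[i]]_m) :=
  \sum_(l < k) peval p g ^+ (k.-1 - l) * (\det g ^+ n) ^+ l.
have polydet : polynomial_function (fun g : 'M[R[i]]_m => \det g ^+ n).
  exact/polynomial_functionX/polynomial_function_det.
have polyp : polynomial_function (peval p) := polynomial_function_peval p.
have pE g : C g -> peval p g = chi g * \det g ^+ n.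
  move=> Cg; rewrite chiE; last exact: CG.
  by rewrite divfK // expf_neq0 // -unitfE -unitmxE Gu //; apply: CG.
have det0 g : C g -> \det g ^+ n != 0.
  by move=> Cg; rewrite expf_neq0 // -unitfE -unitmxE Gu //; apply: CG.
have chiP g : C g -> N g = 0 <-> chi g = 1.
  move=> Cg; rewrite /N pE // -{2}[\det g ^+ n]mul1r -mulrBl; split.
    move=> /eqP; rewrite mulf_eq0 (negPf (det0 g Cg)) orbF subr_eq0.
    by move=> /eqP.
  by move=> ->; rewrite subrr mul0r.
have sub : C `<=` [set g | N g = 0].
  apply: (@connected_clopen_cover (zariski 'M[R[i]]_m) C _ [set g | S g = 0]).
  - exact: Cc.
  - exact/closed_zeros/polynomial_functionB.
  - apply: closed_zeros; apply: polynomial_function_sum => l.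
    by apply: polynomial_functionM; apply: polynomial_functionX.
  (* The product telescopes to [peval p g ^+ k - (\det g ^+ n) ^+ k]. *)
  - move=> g Cg /=; have : N g * S g == 0.
      by rewrite /N /S -subrXX subr_eq0 pE // exprMn chik // mul1r.
    by rewrite mulf_eq0 => /orP[] /eqP; [left|right].
  - apply/seteqP; split=> // g [[/= Ng Sg] Cg].
    have : S g = k%:R * (\det g ^+ n) ^+ k.-1.
      rewrite /S pE // ((chiP g Cg).1 Ng) mul1r mulr_natl.
      rewrite -[k in _ *+ k]card_ord -sumr_const; apply: eq_bigr => l _.
      by rewrite -exprD subnK // -ltnS prednK.
    move=> /eqP; rewrite Sg eq_sym mulf_eq0 expf_eq0 (negPf (det0 g Cg)) andbF.
    by rewrite orbF Num.Theory.pnatr_eq0 eqn0Ngt k0.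
  - by exists g0; split=> //=; apply/chiP.
by move=> g Cg; apply/chiP => //; apply: sub.
Qed.

(** * Isotropy groups at the points [v i] *)

Theorem lemma3p10 (R : realType) (m : nat) (G : set 'M[R[i]]_m)
    (V : vectType R[i]) (rho : 'M[R[i]]_m -> 'End(V)) (Omega : set V)
    (hV : prehomogeneous_space G rho Omega)
    (r : nat) (f : 'I_r -> {mpoly R[i][\dim {:V}]})
    (hf : basic_relative_invariants Omega f)
    (chi : 'I_r -> 'M[R[i]]_m -> R[i])
    (hchi : forall i, relative_invariant G rho Omega (tofrac (f i)) (chi i))
    (v : 'I_r -> V)
    (hv : forall i, zero_locus (f i) (v i))
    (hv' : forall i j, j != i -> ~ zero_locus (f j) (v i)) :
  (forall i j, i != j ->
     isotropy G rho (v i) `<=` character_kernel G (chi j)) /\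
  (forall (h : {fraction {mpoly R[i][\dim {:V}]}}) (Phi : 'M[R[i]]_m -> R[i])
      (h1 g1 : {mpoly R[i][\dim {:V}]}) (d : nat) (k : 'I_r -> nat),
     h != 0 ->
     additive_relative_invariant G rho Omega h Phi ->
     h = tofrac h1 / tofrac g1 ->
     h1 \is d.-homog -> g1 \is d.-homog ->
     no_common_factor h1 g1 ->
     (exists psi, relative_invariant G rho Omega (tofrac g1) psi) ->
     g1 = \prod_(i < r) f i ^+ k i ->
     (forall i, (0 < k i)%N -> peval h1 (v i) != 0 ->
        identity_component (isotropy G rho (v i))
          `<=` character_kernel G (chi i)) /\
     (forall i, k i = 0%N ->
        isotropy G rho (v i) `<=` additive_kernel G Phi)).
Proof.
have part1 i j : i != j -> isotropy G rho (v i) `<=` character_kernel G (chi j).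
  move=> ij; apply: (isotropy_character hV (hchi j)).
  by apply/eqP/hv'; rewrite eq_sym.
split=> // h Phi h1 g1 d k _ ari hE _ _ _ _ g1E; rewrite hE in ari.
have pg1 u : peval g1 u = \prod_(i < r) peval (f i) u ^+ k i.
  by rewrite g1E /peval rmorph_prod; apply: eq_bigr => i _; rewrite rmorphXn.
have g1n0 u : Omega u -> peval g1 u != 0.
  move=> Ou; rewrite pg1; apply/prodf_neq0 => i _; apply: expf_neq0.
  exact: (basic_relative_invariant_neq0 i hf Ou).
have g1rho g u : G g ->
    peval g1 (rho g u) = (\prod_(i < r) chi i g ^+ k i) * peval g1 u.
  move=> Gg; rewrite !pg1 -big_split; apply: eq_bigr => i _ /=.
  by rewrite (relative_invariant_eq hV (hchi i) u Gg) exprMn.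
have key := additive_relative_invariant_eq hV ari g1rho g1n0.
(* By (1), every factor with [j != i] equals 1 here. *)
have psiE i g : isotropy G rho (v i) g ->
    \prod_(j < r) chi j g ^+ k j = chi i g ^+ k i.
  move=> gi; rewrite (bigD1 i) //= big1 ?mulr1 // => j ji.
  by rewrite (part1 i j _ g gi).2 ?expr1n // eq_sym.
split=> i.
  move=> ki h1i g Cg.
  have isoG g' : isotropy G rho (v i) g' -> G g' by case.
  have Csub : identity_component (isotropy G rho (v i)) `<=` isotropy G rho (v i).
    exact: (@connected_component_sub (zariski 'M[R[i]]_m)).
  have [_ [reg chi0 chiM] _] := hchi i.
  have G1 : G 1%:M := lag_one (pv_group hV).
  split; first exact/isoG/Csub.
  apply: (connected_torsion_character ki (lag_unit (pv_group hV)) reg _ _ _ _ Cg).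
  - exact: (@component_connected (zariski 'M[R[i]]_m)).
  - by move=> g' /Csub/isoG.
  - exists 1%:M.
      apply: (@connected_component_refl (zariski 'M[R[i]]_m)); split=> //.
      by rewrite (rep_one (pv_rep hV)) lfunE.
    (* A nonzero idempotent of the field is 1. *)
    by apply: (mulIf (chi0 _ G1)); rewrite -chiM // mul1mx mul1r.
  - move=> {Cg}g /Csub gi; have [Gg gv] := gi.
    (* Since [k i] is positive, [f i] divides [g1]; this removes the [Phi] term from [key], and [h1]
       at [v i] can then be cancelled. *)
    have g1v : peval g1 (v i) = 0.
      rewrite pg1 (bigD1 i) //= (hv i : peval _ _ = 0).
      by rewrite expr0n -leqn0 leqNgt ki mul0r.
    apply: (mulIf h1i); rewrite mul1r -(psiE i g gi).
    by rewrite -[RHS](congr1 (peval h1) gv) key // g1v mulr0 addr0.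
move=> ki g gi; have [Gg gv] := gi; split=> //.
(* With [k i = 0], only the [f j] with [j != i] contribute to [g1], and none of them vanishes at
   [v i]. *)
have g1v : peval g1 (v i) != 0.
  rewrite pg1; apply/prodf_neq0 => j _.
  have [->|ji] := eqVneq j i; first by rewrite ki expr0 oner_eq0.
  by apply: expf_neq0; apply/eqP/hv'.
(* The multiplier in [key] is now 1, so subtracting [h1] at [v i] leaves
   [Phi g * peval g1 (v i) = 0]. *)
have := key g (v i) Gg; rewrite gv (psiE i g gi) ki expr0 mul1r -[LHS]addr0.
move/addrI/esym/eqP; rewrite mulf_eq0 (negPf g1v) orbF.
by move/eqP.
Qed.
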